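(* Let $p\in[1,\infty)$ and let $((S^a)_{a\in I},\mathfrak F,\mathfrak G,T)$ be a standard platonic market that satisfies the (NAFLp) condition (no asymptotic $L^p$-free lunch). Let ${\bm\delta}=(\delta^A)_{A\in\mathcal A}$ be a family of information delays whose delay informations satisfy $\mathfrak H^A\subseteq\mathfrak F^A$ for every $A\in\mathcal A$, and let $\mathfrak F^{\bm\delta}=(\mathfrak F^{A,{\bm\delta}})_{A\in\mathcal A}$ be the corresponding family of delayed filtrations. Then the market $((S^a)_{a\in I},\mathfrak F^{\bm\delta},\mathfrak G,T)$ also satisfies the (NAFLp) condition.
   Context: **Standard platonic market.** Let $T\in(0,\infty]$ and let $(\Omega,\mathcal G,\mathfrak G=(\mathcal G_t)_{t\in[0,T]},\mathbb P)$ be a filtered probability space with $\mathcal G=\mathcal G_T$. Let $I$ be an arbitrary (possibly uncountable) set and, for each $a\in I$, let $S^a=(S^a_t)_{t\in[0,T]}$ be a real-valued $\mathfrak G$-adapted process. For each finite $A\subseteq I$ let $\mathfrak F^A=(\mathcal F^A_t)_{t\in[0,T]}$ be a filtration with $\mathfrak F^A\subseteq\mathfrak G$, i.e. $\mathcal F^A_t\subseteq\mathcal G_t$ for all $t$ (inclusion of filtrations always means inclusion at every time). An index system is a sequence $(\mathcal A^n)_{n\in\mathbb N}$, with $\mathcal A=\bigcup_n\mathcal A^n$, such that (i) $\mathcal A^n\subseteq\{A\subseteq I:|A|=n\}$; (ii) $A_1,A_2\in\mathcal A$ implies $A_1\cup A_2\in\mathcal A$; (iii) $A_1\subseteq A_2$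 in $\mathcal A$ implies $\mathfrak F^{A_1}\subseteq\mathfrak F^{A_2}$. When (iii) holds, the family of filtrations is said to agree with the index system. Such an index system is fixed. The bundle $((S^a)_{a\in I},\mathfrak F,\mathfrak G,T)$ with $\mathfrak F=(\mathfrak F^A)_{A\in\mathcal A}$ is called a standard platonic market. **Trading.** For $A=\{a_1,\dots,a_n\}\in\mathcal A^n$, an $\mathfrak F^A$-simple bounded trading strategy is $\mathbf H^A=\sum_{i=1}^m\mathbf H^A_{t_{i-1}}\mathbb 1_{(t_{i-1},t_i]}$ with deterministic times $t_0<\dots<t_m$ in $[0,T]$ and $\mathbf H^A_{t_{i-1}}=(H^{a_1}_{t_{i-1}},\dots,H^{a_n}_{t_{i-1}})$ an $\mathcal F^A_{t_{i-1}}$-measurable bounded random vector. Its wealth process is $(\mathbf S^A\cdot\mathbf H^A)_t=\sum_{j=1}^n\sum_{i=1}^m H^{a_j}_{t_{i-1}}\mathbb 1_{(t_{i-1},T]}(t)(S^{a_j}_{t_i\wedge t}-S^{a_j}_{t_{i-1}})$. $K_0$ is the set of terminal values (at time $T$) of all wealth processes, over all $A\in\mathcal A$ and all $\mathfrak F^A$-simple bounded strategies. **(NAFLp).** Fix $p\in[1,\infty)$. Let $\mathcal P_p=\{\mathbb P'\sim\mathbb P: K_0\subseteq L^p(\Omega,\mathcal G,\mathbb P')\}$; it is a standing assumption that $\mathcal P_p\neq\emptyset$. Let $C=K_0-L^0_+(\Omega,\mathcal G,\mathbb P)$ and $C_p(\mathbb P')=C\cap L^p(\Omega,\mathcal G,\mathbb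 P')$. The market satisfies (NAFLp) iff for some $\mathbb P'\in\mathcal P_p$, $\overline{C_p(\mathbb P')}\cap L^p_+(\Omega,\mathcal G,\mathbb P')=\{0\}$, the closure being in the $L^p(\Omega,\mathcal G,\mathbb P')$-norm. All these objects ($K_0$, $\mathcal P_p$, $C$) are formed from the market in question; in particular for the delayed market they use the filtrations $\mathfrak F^{A,{\bm\delta}}$. **Information delay.** A pair $(\mathfrak H,\delta)$, with $\mathfrak H=(\mathcal H_t)_{t\in[0,T]}\subseteq\mathfrak G$ a filtration (the delay information) and $(\delta(t))_{t\in[0,T]}$ a real-valued process, is an information delay if (i) each $\delta(t)$ is an $\mathfrak H$-stopping time; (ii) $0\le\delta(t)\le t$ for all $t\in[0,T]$; (iii) $\delta(t,\omega)\le\delta(s,\omega)$ for all $0\le t\le s\le T$, $\omega\in\Omega$. If $\mathfrak H\subseteq\mathfrak F^A$, put $\mathcal F^{A,\delta}_t:=\mathcal F^A_{\delta(t)}$, where for a stopping time $\tau$, $\mathcal F^A_\tau=\{F\in\mathcal F^A_T: F\cap\{\tau\le u\}\in\mathcal F^A_u\ \forall u\in[0,T]\}$. For a family ${\bm\delta}=(\delta^A)_{A\in\mathcal A}$ of information delays with delay informations $\mathfrak H^A\subseteq\mathfrak F^A$, the filtrations $\mathfrak F^{A,{\bm\delta}}=(\mathcal F^{A,{\bm\delta}}_t)_{t\in[0,T]}$ are defined recursively (over $|A|$) by $$\mathcal F^{A,{\bm\delta}}_t=\sigma\Big(\mathcal F^{A,\delta^A}_t\cup\bigcup_{A'\in\mathcal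 A,\,A'\subsetneq A}\mathcal F^{A',{\bm\delta}}_t\Big).$$ *)

(* Defs.v *)
From HB Require Import structures.
From mathcomp Require Import all_boot all_order all_algebra finmap.
From mathcomp Require Import all_classical all_reals all_analysis.

Set Implicit Arguments.
Unset Strict Implicit.
Unset Printing Implicit Defensive.

Import Order.TTheory GRing.Theory Num.Theory.
Import numFieldNormedType.Exports.

Local Open Scope classical_set_scope.
Local Open Scope ring_scope.

(* Times live in the extended reals, so that the horizon T may be +oo, in
   which case [0, T] contains +oo.  Time-indexed families are total functions
   on [\bar R]; only their values on [times T] are ever constrained or used. *)
Definition times (R : realType) (T : \bar R) : set (\bar R) :=
  [set t | (0 <= t)%E /\ (t <= T)%E].

Section Filtrations.
Context {R : realType} {Omega : Type}.
Implicit Types (T t u : \bar R) (F G H : \bar R -> set (set Omega)).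

Definition is_filtration T F : Prop :=
  (forall t, times T t -> sigma_algebra setT (F t)) /\
  (forall s t, times T s -> times T t -> (s <= t)%E -> F s `<=` F t).

Definition subfiltration T F G : Prop := forall t, times T t -> F t `<=` G t.

Definition measurable_wrt (F : set (set Omega)) (f : Omega -> R) : Prop :=
  forall B : set R, measurable B -> F (f @^-1` B).

Definition stopping_time T F (tau : Omega -> R) : Prop :=
  forall u, times T u -> F u [set w | ((tau w)%:E <= u)%E].

Definition stopped_sigma_algebra T F (tau : Omega -> R) : set (set Omega) :=
  [set E | F T E /\
    forall u, times T u -> F u (E `&` [set w | ((tau w)%:E <= u)%E])].

Definition information_delay T G H (delta : \bar R -> Omega -> R) : Prop :=
  [/\ is_filtration T H,
      subfiltration T H G,
      forall t, times T t -> stopping_time T H (delta t),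
      forall t w, times T t -> 0 <= delta t w /\ ((delta t w)%:E <= t)%E
    & forall s t w, times T s -> times T t -> (t <= s)%E ->
        delta t w <= delta s w].

End Filtrations.

Record index_system (I : choiceType) := IndexSystem {
  level : nat -> set {fset I};
  level_card : forall n A, level n A -> #|` A| = n;
  levelU : forall m n A B, level m A -> level n B ->
    exists k, level k (A `|` B)%fset }.

Definition index_set (I : choiceType) (AA : index_system I) : set {fset I} :=
  \bigcup_n level AA n.

(* [trader_info M A] is the filtration of the trader with index A; it is
   meaningful only for A in the index system. *)
Record platonic_market (R : realType) d (Omega : measurableType d)
    (I : choiceType) (AA : index_system I) := PlatonicMarket {
  horizon : \bar R;
  horizon_gt0 : (0 < horizon)%E;
  full_info : \bar R -> set (set Omega);
  full_info_filtration : is_filtration horizon full_info;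
  full_info_horizon : full_info horizon = measurable;
  price : I -> \bar R -> Omega -> R;
  price_adapted : forall a t, times horizon t ->
    measurable_wrt (full_info t) (price a t);
  trader_info : {fset I} -> \bar R -> set (set Omega);
  trader_info_filtration : forall A, index_set AA A ->
    is_filtration horizon (trader_info A);
  trader_info_full : forall A, index_set AA A ->
    subfiltration horizon (trader_info A) full_info;
  trader_info_agrees : forall A B, index_set AA A -> index_set AA B ->
    (A `<=` B)%fset -> subfiltration horizon (trader_info A) (trader_info B) }.

Section Trading.
Context {R : realType} {d : measure_display} {Omega : measurableType d}.
Context {I : choiceType} {AA : index_system I}.
Implicit Type M : platonic_market R Omega AA.

(* Trading dates are t 0 < ... < t m, and [H i a] is the position in asset a
   held on the interval (t i, t i.+1]. *)
Definition simple_bounded_strategy M (A : {fset I}) (m : nat)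
    (t : nat -> \bar R) (H : nat -> I -> Omega -> R) : Prop :=
  [/\ forall i, (i <= m)%N -> times (horizon M) (t i),
      forall i, (i < m)%N -> (t i < t i.+1)%E,
      forall i a, (i < m)%N -> a \in A ->
        measurable_wrt (trader_info M A (t i)) (H i a)
    & exists c : R, forall i a w, (i < m)%N -> a \in A -> `|H i a w| <= c].

Definition wealth M (A : {fset I}) (m : nat) (t : nat -> \bar R)
    (H : nat -> I -> Omega -> R) (u : \bar R) : Omega -> R :=
  fun w => \sum_(a <- A) \sum_(i < m)
    H i a w * ((t i < u)%E && (u <= horizon M)%E)%:R *
    (price M a (Order.min (t i.+1) u) w - price M a (t i) w).

Definition K0 M : set (Omega -> R) :=
  [set k | exists A m t H, [/\ index_set AA A,
     simple_bounded_strategy M A m t H & k = wealth M A m t H (horizon M)]].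

End Trading.

(* L^0 and L^p are spaces of classes of random variables up to a.s. equality.
   Below, a set of such classes is represented by the set of all the
   measurable functions belonging to one of them. *)
Section NoFreeLunch.
Context {R : realType} {d : measure_display} {Omega : measurableType d}.
Context {I : choiceType} {AA : index_system I}.
Implicit Types (M : platonic_market R Omega AA) (P Q : probability Omega R).
Implicit Type p : R.

Definition L0_nonneg P : set (Omega -> R) :=
  [set h : Omega -> R | measurable_fun setT h /\ {ae P, forall w, 0 <= h w}].

Definition Lp Q p : set (Omega -> R) := [set f | f \in Lfun Q p%:E].

Definition Lp_nonneg Q p : set (Omega -> R) :=
  Lp Q p `&` [set f : Omega -> R | {ae Q, forall w, 0 <= f w}].

Definition Lp_zero Q p : set (Omega -> R) :=
  Lp Q p `&` [set f : Omega -> R | {ae Q, forall w, f w = 0}].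

Definition Lp_closure Q p (X : set (Omega -> R)) : set (Omega -> R) :=
  Lp Q p `&` [set f : Omega -> R | forall e : R, 0 < e ->
    exists2 g, X g & ('N[Q]_p%:E [EFin \o (f \- g)%R] < e%:E)%E].

Definition equivalent_probability P Q : Prop := Q `<< P /\ P `<< Q.

Definition pricing_probabilities P p M : set (probability Omega R) :=
  [set Q | equivalent_probability P Q /\ K0 M `<=` Lp Q p].

(* K_0 - L^0_+; since h ranges over all versions, this set is closed under a.s.
   modification within measurable functions. *)
Definition superreplicable P M : set (Omega -> R) :=
  [set f | exists k h, [/\ K0 M k, L0_nonneg P h & f = k \- h]].

Definition NAFLp P p M : Prop :=
  exists2 Q, pricing_probabilities P p M Q &
    Lp_closure Q p (superreplicable P M `&` Lp Q p) `&` Lp_nonneg Q p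
    = Lp_zero Q p.

End NoFreeLunch.

Section Delay.
Context {R : realType} {d : measure_display} {Omega : measurableType d}.
Context {I : choiceType} {AA : index_system I}.

Record delay_family (M : platonic_market R Omega AA) := DelayFamily {
  delay_info : {fset I} -> \bar R -> set (set Omega);
  delay : {fset I} -> \bar R -> Omega -> R;
  delayP : forall A, index_set AA A ->
    information_delay (horizon M) (full_info M) (delay_info A) (delay A);
  delay_info_sub : forall A, index_set AA A ->
    subfiltration (horizon M) (delay_info A) (trader_info M A) }.

Context (M : platonic_market R Omega AA) (D : delay_family M).

Definition own_delayed_info (A : {fset I}) (t : \bar R) : set (set Omega) :=
  stopped_sigma_algebra (horizon M) (trader_info M A) (delay D A t).

(* The recursion over the cardinality of A is implemented with fuel n, any
   n > #|A| being enough; the intended recursive equation is [delayed_infoE]. *)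
Fixpoint delayed_info_rec (n : nat) (A : {fset I}) (t : \bar R) :
    set (set Omega) :=
  if n is n'.+1 then
    <<s own_delayed_info A t `|`
        \bigcup_(B in [set B | index_set AA B /\ fproper B A])
          delayed_info_rec n' B t >>
  else set0.

Definition delayed_info (A : {fset I}) : \bar R -> set (set Omega) :=
  delayed_info_rec #|` A|.+1 A.

Lemma delayed_info_rec_fuel n A t : (#|` A| < n)%N ->
  delayed_info_rec n A t = delayed_info A t.
Proof.
suff fuel m k B : (#|` B| < m)%N -> (#|` B| < k)%N ->
    delayed_info_rec m B t = delayed_info_rec k B t.
  by move=> An; exact: fuel.
elim: m k B => // m IHm [//|k] B Bm Bk /=.
congr (<<s _ `|` _ >>); apply: eq_bigcupr => C [_ CB].
by apply: IHm; apply: leq_trans (fproper_ltn_card CB) _.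
Qed.

Lemma delayed_infoE A t : delayed_info A t =
  <<s own_delayed_info A t `|`
      \bigcup_(B in [set B | index_set AA B /\ fproper B A])
        delayed_info B t >>.
Proof.
rewrite {1}/delayed_info /=; congr (<<s _ `|` _ >>).
apply: eq_bigcupr => B [_ BA].
exact: delayed_info_rec_fuel (fproper_ltn_card BA).
Qed.

Lemma delayed_info_ind (X : \bar R -> set (set Omega)) A t :
  sigma_algebra setT (X t) ->
  (forall B, index_set AA B -> own_delayed_info B t `<=` X t) ->
  index_set AA A -> delayed_info A t `<=` X t.
Proof.
move=> sX ownX; have [n] := ubnP #|` A|; elim: n A => // n IHn A An AA_A.
rewrite delayed_infoE; apply: smallest_sub => // E [/(ownX _ AA_A)//|].
move=> [B [AA_B BA]]; apply: IHn => //.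
exact: leq_trans (fproper_ltn_card BA) An.
Qed.

Lemma own_delayed_info_full A t : index_set AA A -> times (horizon M) t ->
  own_delayed_info A t `<=` full_info M t.
Proof.
move=> AA_A Tt E [_ /(_ t Tt)]; have [_ _ _ delta_le _] := delayP D AA_A.
have -> : [set w | ((delay D A t w)%:E <= t)%E] = setT.
  by apply/seteqP; split=> // w _; have [] := delta_le t w Tt.
by rewrite setIT; exact: trader_info_full.
Qed.

Lemma own_delayed_info_mono A s t : index_set AA A ->
  times (horizon M) s -> times (horizon M) t -> (s <= t)%E ->
  own_delayed_info A s `<=` own_delayed_info A t.
Proof.
move=> AA_A Ts Tt st E [FE Es]; split=> // u Tu.
have [_ _ stop _ mono] := delayP D AA_A.
have [sF _] := @trader_info_filtration _ _ _ _ _ M A AA_A.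
have -> : E `&` [set w | ((delay D A t w)%:E <= u)%E] =
    (E `&` [set w | ((delay D A s w)%:E <= u)%E]) `&`
    [set w | ((delay D A t w)%:E <= u)%E].
  apply/seteqP; split=> w [] => [Ew tu|[Ew _] tu]; split=> //; split=> //=.
  by apply: le_trans tu; rewrite lee_fin; exact: mono.
have /sigma_algebraP-/(_ (fun _ _ => subsetT _))[_ _ _ FI] := sF u Tu.
by apply: FI; [exact: Es | exact: (delay_info_sub AA_A) (stop t Tt u Tu)].
Qed.

Lemma delayed_info_filtration A : index_set AA A ->
  is_filtration (horizon M) (delayed_info A).
Proof.
move=> AA_A; split=> [t Tt|s t Ts Tt st].
  by rewrite delayed_infoE; exact: smallest_sigma_algebra.
have [n] := ubnP #|` A|; elim: n A AA_A => // n IHn A AA_A An.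
rewrite !delayed_infoE; apply: sub_sigma_algebra2; apply: setUSS.
  exact: own_delayed_info_mono.
apply: subset_bigcup => B [AA_B BA]; apply: IHn => //.
exact: leq_trans (fproper_ltn_card BA) An.
Qed.

Lemma delayed_info_full A : index_set AA A ->
  subfiltration (horizon M) (delayed_info A) (full_info M).
Proof.
move=> AA_A t Tt; have [sG _] := full_info_filtration M.
apply: (delayed_info_ind (sG t Tt)) => // B AA_B.
exact: own_delayed_info_full.
Qed.

Lemma delayed_info_agrees A B : index_set AA A -> index_set AA B ->
  (A `<=` B)%fset ->
  subfiltration (horizon M) (delayed_info A) (delayed_info B).
Proof.
move=> AA_A AA_B; rewrite fsubEproper.
move=> /orP[/eqP-> t _ E|AB t Tt E AE]; first exact.
rewrite delayed_infoE; apply: sub_sigma_algebra.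
by right; exists A.
Qed.

Definition delayed_market : platonic_market R Omega AA :=
  {| horizon_gt0 := horizon_gt0 M;
     full_info_filtration := full_info_filtration M;
     full_info_horizon := full_info_horizon M;
     price_adapted := @price_adapted _ _ _ _ _ M;
     trader_info_filtration := delayed_info_filtration;
     trader_info_full := delayed_info_full;
     trader_info_agrees := delayed_info_agrees |}.

End Delay.

(* Main.v *)
(** Since [delta t <= t], information stopped at [delta t] is already known at
    time [t].  Hence every delayed strategy is a strategy of the original market,
    so delaying information shrinks [K_0], and with it the set whose closure must
    avoid the nonzero nonnegative payoffs. *)
Require Import Defs.
From mathcomp Require Import all_boot all_order all_algebra finmap.
From mathcomp Require Import all_classical all_reals all_analysis.
Local Open Scope ring_scope.
Import Order.TTheory GRing.Theory Num.Theory.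
Local Open Scope classical_set_scope.

Set Implicit Arguments.
Unset Strict Implicit.
Unset Printing Implicit Defensive.

Section MarketInclusion.
Context {R : realType} {d : measure_display} {Omega : measurableType d}.
Context {I : choiceType} {AA : index_system I}.
Implicit Types (M N : platonic_market R Omega AA) (P Q : probability Omega R).

Lemma superreplicable_sub P M N : K0 M `<=` K0 N ->
  superreplicable P M `<=` superreplicable P N.
Proof. by move=> MN f [k [h [/MN Nk h0 ->]]]; exists k, h. Qed.

Lemma Lp_closure_sub Q (p : R) (X Y : set (Omega -> R)) : X `<=` Y ->
  Lp_closure Q p X `<=` Lp_closure Q p Y.
Proof.
move=> XY f [Lf clf]; split=> // e e0.
by have [g /XY Yg fg] := clf e e0; exists g.
Qed.

Lemma sub_Lp_closure Q (p : R) (X : set (Omega -> R)) : 0 < p ->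
  X `<=` Lp Q p -> X `<=` Lp_closure Q p X.
Proof.
move=> p0 XL f Xf; split=> [|e e0]; first exact: XL.
exists f => //.
rewrite (_ : EFin \o _ = cst 0%E); last first.
  by apply/funext => w /=; rewrite subrr.
by rewrite Lnorm0 ?lte_fin // eqe gt_eqF.
Qed.

Lemma K0_zero M (A : {fset I}) : index_set AA A -> K0 M (cst 0).
Proof.
(* With [m = 0] there is no trading interval, so the wealth is an empty sum; the only date, [0],
   lies in [times] because the horizon is positive. *)
move=> AA_A; exists A, 0%N, (fun=> 0%E), (fun _ _ => cst 0); split=> //.
  split=> // [i _|]; last by exists 0.
  by split=> //; exact: ltW (horizon_gt0 M).
by apply/funext => w; rewrite /wealth big1 // => a _; rewrite big_ord0.
Qed.

(** Write [f] as [0 - (- f)]: the exceptional set of [f] is [Q]-null, hence [P]-null, so [- f] lies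
    in [L0_nonneg P]. This handles all versions of zero, as the set equality in [NAFLp] requires. *)
Lemma Lp_zero_superreplicable P Q (p : R) M : P `<< Q -> K0 M (cst 0) ->
  Lp_zero Q p `<=` superreplicable P M.
Proof.
move=> PQ K00 f [Lf f0]; exists (cst 0), (\- f); split=> //; last first.
  by apply/funext => w /=; rewrite sub0r opprK.
have mf : measurable_fun setT f by have := sub_Lfun_mfun Lf; rewrite inE.
split; first exact: measurableT_comp.
have [N [mN QN0 fN]] := f0.
have f0P : {ae P, forall w, f w = 0}.
  by exists N; split=> //; apply: (null_content_dominatesP _ _).1 PQ _ mN QN0.
by apply: filterS f0P => w /= ->; rewrite oppr0.
Qed.

(** The same [Q] serves both markets. One inclusion is monotonicity of the closure; the other needs
    the zero payoff in [K0 M], hence some trader. *)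
Lemma NAFLp_antimono P (p : R) M N : 1 <= p -> K0 M `<=` K0 N ->
  NAFLp P p N -> NAFLp P p M.
Proof.
move=> p1 MN [Q [[QP PQ] KN] closN]; exists Q.
  by split=> //; exact: subset_trans KN.
have p0 : 0 < p by exact: lt_le_trans p1.
(* The index system could be empty a priori. But [closN] puts [cst 0] in the closure for [N], so
   some superreplicable [g] exists within distance [1], and the payoff above it comes with an
   index. *)
have [A AA_A] : index_set AA !=set0.
  have : Lp_zero Q p (cst 0) by split; [exact: Lfun_cst | exact: aeW].
  rewrite -closN => -[[_ /(_ 1 ltr01)[g [[k [h [[A [m [t [H [AA_A _ _]]]]]]]]]]] _].
  by exists A.
have K00 := @K0_zero M A AA_A.
apply/seteqP; split.
  rewrite -closN; apply: setSI; apply: Lp_closure_sub; apply: setSI.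
  exact: superreplicable_sub.
move=> f f0; have [Lf fw0] := f0; split.
  apply: sub_Lp_closure => //.
  by split=> //; exact: Lp_zero_superreplicable f0.
by split=> //; apply: filterS fw0 => w /= ->.
Qed.

(** Information enters a strategy only through measurability of its positions, so the same dates and
    positions can be kept. *)
Lemma K0_trader_info_sub M N :
  horizon M = horizon N -> price M = price N ->
  (forall A, index_set AA A ->
    subfiltration (horizon M) (trader_info M A) (trader_info N A)) ->
  K0 M `<=` K0 N.
Proof.
move=> hMN SMN MN k [A [m [t [H [AA_A [Tt tm mH bH] ->]]]]].
exists A, m, t, H; split=> //; last by rewrite /wealth hMN SMN.
split=> //; first by rewrite -hMN.
by move=> i a im aA B mB; apply: (MN A AA_A (t i) (Tt i (ltnW im))); exact: mH.
Qed.

End MarketInclusion.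

Section DelayedMarket.
Context {R : realType} {d : measure_display} {Omega : measurableType d}.
Context {I : choiceType} {AA : index_system I}.
Context {M : platonic_market R Omega AA} (D : delay_family M).

(** Take [u = t] in the definition of the stopped sigma-algebra: the event that the delay is at most
    [t] is the whole space. *)
Lemma own_delayed_info_sub A t : index_set AA A -> times (horizon M) t ->
  own_delayed_info D A t `<=` trader_info M A t.
Proof.
move=> AA_A Tt E [_ /(_ t Tt)]; have [_ _ _ delta_le _] := delayP D AA_A.
rewrite (_ : [set w | _] = setT) ?setIT//.
by apply/seteqP; split=> // w _; have [] := delta_le t w Tt.
Qed.

(** Induction on the cardinality of [A]. The bound must vary with the trader: [delayed_info_ind]
    would ask [trader_info M A] to contain the own delayed information of every trader, not just of
    subsets of [A]. *)
Lemma delayed_info_sub A : index_set AA A ->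
  subfiltration (horizon M) (delayed_info D A) (trader_info M A).
Proof.
move=> AA_A t Tt; have [n] := ubnP #|` A|.
elim: n A AA_A => // n IHn A AA_A An.
have [sF _] := @trader_info_filtration _ _ _ _ _ M A AA_A.
rewrite delayed_infoE; apply: smallest_sub; first exact: sF.
move=> E [/(own_delayed_info_sub AA_A Tt)//|[B [AA_B BA] BE]].
(* What a proper subset [B] contributes is bounded by [trader_info M B], which agreement with the
   index system places inside that of [A]. *)
apply: (trader_info_agrees AA_B AA_A (fproper_sub BA) Tt).
by apply: (IHn B) => //; exact: leq_trans (fproper_ltn_card BA) An.
Qed.

End DelayedMarket.

Theorem theorem5 (R : realType) (d : measure_display) (Omega : measurableType d)
    (P : probability Omega R) (I : choiceType) (AA : index_system I)
    (M : platonic_market R Omega AA) (D : delay_family M)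
    (p : R) (hp : 1 <= p) :
  NAFLp P p M -> NAFLp P p (delayed_market D).
Proof.
apply: NAFLp_antimono => //; apply: K0_trader_info_sub => //.
by move=> A; exact: (@delayed_info_sub _ _ _ _ _ M D).
Qed.
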